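(* Let $\Delta\subset\mathbb{C}$ be a disk centred at $0$ with coordinate $t$ and $\Delta^*=\Delta-\{0\}$. Let $\underline A_1,\underline A_2,\underline B_1,\underline B_2\subset\mathbb{P}^n_\Delta$ form a flat holomorphic family whose fibres $\underline A_i(t),\underline B_j(t)$ constitute a complementary configuration of type $(k,n)$ for every $t\in\Delta^*$. Let $A_i^s,B_j^s\subset\mathbb{P}^n_{\mathbb{C}}$ be the fibres over $t=0$. Write $$\langle\underline A_1(t)-\underline A_2(t),\,\underline B_1(t)-\underline B_2(t)\rangle_\infty=\log|(\underline A_1(t),\underline A_2(t);\underline B_1(t),\underline B_2(t))|=m\log|t|+\log|u(t)|,\quad|t|\ll1,$$ where the cross-ratio equals $t^mu(t)$ with $m\in\mathbb{Z}$ and $u$ holomorphic and non-zero at $t=0$. Let $\mathfrak{c}_{\mathrm{lim}}$ be the limit perturbation induced by the family over $R=\mathcal{O}_{\Delta,0}$ with uniformiser $t$. Then $$u(0)=(A_1^s,A_2^s;B_1^s,B_2^s)_{\mathfrak{c}_{\mathrm{lim}}}.$$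
   Context: Notation: $\det W=\bigwedge^{\dim W}W$ (so $\det 0$ is the base field), and $\hat A$ denotes the linear subspace of the ambient vector space whose projectivisation is $A$. $\langle\cdot,\cdot\rangle_\infty$ is the Archimedean height pairing, which for a complementary configuration over $\mathbb{C}$ equals $\log$ of the absolute value of the cross-ratio. **Cross-ratio.** A complementary configuration of type $(k,n)$ over a field $K$ is a quadruple of linear subspaces $A_1,A_2,B_1,B_2\subset\mathbb{P}(V)$, $\dim V=n+1$, with $\dim A_i=k$, $\dim B_j=n-k-1$, $A_i\cap B_j=\emptyset$ for all $i,j$. With generators $a_i\in\det\hat A_i$, $b_j\in\det\hat B_j$, its cross-ratio is $$(A_1,A_2;B_1,B_2)=\frac{a_1\wedge b_1}{a_1\wedge b_2}\,\frac{a_2\wedge b_2}{a_2\wedge b_1}\in K^\times.$$ **Degenerate cross-ratio.** A degenerate complementary configuration is the same without any assumption on $A_i\cap B_j$. Put $\hat S_{ij}=\hat A_i\cap\hat B_j$ and $\hat Q_{ij}=V/(\hat A_i+\hat B_j)$. There is a canonical isomorphism $$\det\hat A_i\otimes\det\hat B_j\otimes\mathrm{Hom}(\det\hat S_{ij},\det\hat Q_{ij})\xrightarrow{\ \sim\ }\det V\qquad( * )$$ given by $a\otimes b\otimes\phi\mapsto a\wedge b'\wedge\phi(s)$, where $s$ generates $\det\hat S_{ij}$, $\hat B_j=B'\oplus\hat S_{ij}$, and $b'\in\det B'$ is such that $b=b'\wedge s$. Given $\mathfrak{c}=(\mathfrak{c}_{11},\mathfrak{c}_{12},\mathfrak{c}_{21},\mathfrak{c}_{22})$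 with $0\ne\mathfrak{c}_{ij}\in\mathrm{Hom}(\det\hat S_{ij},\det\hat Q_{ij})$, define $$(A_1,A_2;B_1,B_2)_{\mathfrak{c}}=\frac{a_1\otimes b_1\otimes\mathfrak{c}_{11}}{a_1\otimes b_2\otimes\mathfrak{c}_{12}}\,\frac{a_2\otimes b_2\otimes\mathfrak{c}_{22}}{a_2\otimes b_1\otimes\mathfrak{c}_{21}},$$ the ratios being computed in $\det V$ via $( * )$; this is independent of the generators $a_i,b_j$. **Limit perturbation.** Let $R=\mathcal{O}_{\Delta,0}$ be the discrete valuation ring of germs of holomorphic functions at $0$, with maximal ideal $\mathfrak{m}=(t)$, fraction field $K$, residue field $\mathbb{C}$ and valuation $v_R$. Let $A_i,B_j\subset\mathbb{P}^n_K$ be the generic fibres of the family, $\mathcal{V}=R^{n+1}$, $V^s=\mathbb{C}^{n+1}$. For each $(i,j)$ let $\hat{\mathcal{A}}_i=\hat A_i\cap\mathcal{V}$, $\hat{\mathcal{B}}_j=\hat B_j\cap\mathcal{V}$, so that $\hat A_i^s=\hat{\mathcal{A}}_i\otimes_R\mathbb{C}$ and $\hat B_j^s=\hat{\mathcal{B}}_j\otimes_R\mathbb{C}$. Let $\Psi_{ij}:\hat{\mathcal{A}}_i\oplus\hat{\mathcal{B}}_j\to\mathcal{V}$ be the sum of the inclusions, $\det\Psi_{ij}:\det\hat{\mathcal{A}}_i\otimes\det\hat{\mathcal{B}}_j\to\det\mathcal{V}$, and let $v_R(\det\Psi_{ij})$ be its valuation with respect to $R$-bases. Then $\mathrm{reg}_t\det\Psi_{ij}:=\big(t^{-v_R(\det\Psi_{ij})}\det\Psi_{ij}\bmod\mathfrak{m}\big):\det\hat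 A_i^s\otimes\det\hat B_j^s\to\det V^s$ is an isomorphism. Via $( * )$ over $\mathbb{C}$ it corresponds to a unique non-zero $\mathfrak{c}_{\mathrm{lim},ij}\in\mathrm{Hom}(\det\hat S_{ij},\det\hat Q_{ij})$, where $\hat S_{ij}=\hat A_i^s\cap\hat B_j^s$, $\hat Q_{ij}=V^s/(\hat A_i^s+\hat B_j^s)$; i.e. $a\otimes b\otimes\mathfrak{c}_{\mathrm{lim},ij}\mapsto(\mathrm{reg}_t\det\Psi_{ij})(a\otimes b)$ under $( * )$. Set $\mathfrak{c}_{\mathrm{lim}}=(\mathfrak{c}_{\mathrm{lim},ij})_{i,j}$. *)

(* Defs.v *)
From HB Require Import structures.
From mathcomp Require Import all_boot all_order all_algebra.
From mathcomp Require Import complex.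
From mathcomp Require Import all_classical all_reals all_analysis.

Set Implicit Arguments.
Unset Strict Implicit.
Unset Printing Implicit Defensive.

Import Order.TTheory GRing.Theory Num.Theory numFieldNormedType.Exports.

Local Open Scope classical_set_scope.
Local Open Scope ring_scope.
Local Open Scope complex_scope.

Section ExteriorAlgebra.
Context {F : fieldType} {N : nat}.
Local Notation V := 'rV[F]_N.

(* The exterior algebra of V = F^N: x : ext stands for
   \sum_S x S *: e_S, where e_S = e_(i_1) /\ ... /\ e_(i_d) for
   S = {i_1 < ... < i_d}; e_set0 is the unit. *)
Definition ext := {ffun {set 'I_N} -> F^o}.

Definition inversions (S T : {set 'I_N}) : nat :=
  #|[set p : 'I_N * 'I_N | [&& p.1 \in S, p.2 \in T & (p.2 < p.1)%N]]|.

(* e_S /\ e_T = (-1)^(inversions S T) e_(S :|: T) if S and T are disjoint,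
   and 0 otherwise. *)
Definition wedge (x y : ext) : ext :=
  [ffun U : {set 'I_N} => \sum_(S : {set 'I_N} | S \subset U)
     (-1) ^+ inversions S (U :\: S)%SET * x S * y (U :\: S)%SET].

Definition ext_one : ext := [ffun S : {set 'I_N} => (S == finset.set0)%:R].

Definition ext_vec (v : V) : ext :=
  [ffun S : {set 'I_N} => \sum_(i | S == [set i]%SET) v 0 i].

Definition wedges (s : seq V) : ext :=
  \big[wedge/ext_one]_(v <- s) ext_vec v.

(* The exterior power of degree d of a subspace W, inside that of V: the span
   of the products of d elements of a basis of W. *)
Definition ext_power (d : nat) (W : {vspace V}) : {vspace ext} :=
  (\sum_(f : {ffun 'I_d -> 'I_(\dim W)})
     <[wedges [seq (vbasis W)`_(f i) | i : 'I_d]]>)%VS.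

Definition detv (W : {vspace V}) : {vspace ext} := ext_power (\dim W) W.

(* A generator of the line detv W (it is ext_one when W = 0). *)
Definition detgen (W : {vspace V}) : ext := wedges (vbasis W).

(* The coordinate on the line det V given by its basis e_1 /\ ... /\ e_N;
   the ratio of two elements of det V is the ratio of their coordinates. *)
Definition det_coord (x : ext) : F := x finset.setT.

(* V/U is represented by the complement U^C, which the projection V -> V/U
   maps isomorphically onto V/U; a form on V/U is thereby lifted to V. *)
Definition detquo (U : {vspace V}) : {vspace ext} := detv (U^C)%VS.

(* Hom(det S, det Q) for S = A :&: B and Q = V/(A + B) *)
Definition perturbation (A B : {vspace V}) : Type :=
  'Hom(subvs_of (detv (A :&: B)%VS), subvs_of (detquo (A + B)%VS)).

(* The canonical isomorphism a (x) b (x) phi |-> a /\ b' /\ phi s, for the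
   generator s of det S and the complement B' = B :\: A of S = A :&: B in B;
   b' is the element of the line det B' such that b = b' /\ s. The result does
   not depend on these choices, nor on the lift of phi s from V/(A + B) to V,
   because a /\ b' belongs to det (A + B). *)
Definition canonical_iso (A B : {vspace V}) (a b : ext)
    (phi : perturbation A B) : ext :=
  let s := detgen (A :&: B)%VS in
  let beta := detgen (B :\: A)%VS in
  let b' := coord [tuple wedge beta s] ord0 b *: beta in
  wedge (wedge a b') (vsval (phi (vsproj (detv (A :&: B)%VS) s))).

(* The projective subspaces P(A_i) and P(B_j) of P(V) = P^(N-1). Projective
   subspaces are disjoint when the linear ones meet in 0. *)
Definition complementary (k : nat) (A1 A2 B1 B2 : {vspace V}) : Prop :=
  [/\ (\dim A1 = k.+1 /\ \dim A2 = k.+1),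
      (\dim B1 = N - k.+1 /\ \dim B2 = N - k.+1)%N,
      (A1 :&: B1 = 0 /\ A1 :&: B2 = 0)%VS
    & (A2 :&: B1 = 0 /\ A2 :&: B2 = 0)%VS].

(* In both cross-ratios each generator occurs once above and once below, so
   that the choice of detgen is immaterial. *)
Definition cross_ratio (A1 A2 B1 B2 : {vspace V}) : F :=
  let a1 := detgen A1 in let a2 := detgen A2 in
  let b1 := detgen B1 in let b2 := detgen B2 in
  det_coord (wedge a1 b1) / det_coord (wedge a1 b2) *
  (det_coord (wedge a2 b2) / det_coord (wedge a2 b1)).

Definition degenerate_cross_ratio (A1 A2 B1 B2 : {vspace V})
    (c11 : perturbation A1 B1) (c12 : perturbation A1 B2)
    (c21 : perturbation A2 B1) (c22 : perturbation A2 B2) : F :=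
  let a1 := detgen A1 in let a2 := detgen A2 in
  let b1 := detgen B1 in let b2 := detgen B2 in
  det_coord (canonical_iso a1 b1 c11) / det_coord (canonical_iso a1 b2 c12) *
  (det_coord (canonical_iso a2 b2 c22) / det_coord (canonical_iso a2 b1 c21)).

End ExteriorAlgebra.

(* R[i], seen as a numClosedFieldType so that it carries the topology and the
   normed space structure of a numFieldType. *)
Definition Cx (R : realType) : numClosedFieldType := R[i].

Section HolomorphicFamilies.
Context {R : realType}.
Local Notation C := (Cx R).

Definition cmod (z : C) : R := complex.Re (`|z| : R[i]).

Definition disk (r : R) : set C := [set z : C | cmod z < r].

Definition holomorphic_near (z : C) (f : C -> C) : Prop :=
  \forall t \near z, derivable (f : C^o -> C^o) t 1.

Definition vholomorphic_near (N : nat) (z : C) (a : C -> 'rV[C]_N) : Prop :=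
  forall j, holomorphic_near z (fun t => a t 0 j).

(* A flat family over the disk of projective subspaces of dimension d - 1 is a
   holomorphic subbundle of rank d of the trivial bundle: every point of the
   disk, 0 included, has a neighbourhood with a holomorphic frame. *)
Definition holomorphic_family (N : nat) (r : R) (d : nat)
    (A : C -> {vspace 'rV[C]_N}) : Prop :=
  forall z, disk r z -> exists a : 'I_d -> C -> 'rV[C]_N,
    (forall i, vholomorphic_near z (a i)) /\
    \forall t \near z, basis_of (A t) [seq a i t | i : 'I_d].

(* O_(Delta,0) is the ring of the f with holomorphic_near 0 f, modulo equality
   near 0. Elements of the lattice given by the intersection of the generic
   fibre of A with O_(Delta,0)^N are the holomorphic vector germs which lie in
   the family outside 0. *)
Definition lattice (N : nat) (A : C -> {vspace 'rV[C]_N})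
    (a : C -> 'rV[C]_N) : Prop :=
  vholomorphic_near 0 a /\ \forall t \near (0 : C)^', a t \in A t.

Definition lattice_basis (N : nat) (A : C -> {vspace 'rV[C]_N})
    (d : nat) (a : 'I_d -> C -> 'rV[C]_N) : Prop :=
  [/\ forall i, lattice A (a i),
      forall x, lattice A x -> exists f : 'I_d -> C -> C,
        (forall i, holomorphic_near 0 (f i)) /\
        \forall t \near (0 : C), x t = \sum_i f i t *: a i t
    & forall f : 'I_d -> C -> C, (forall i, holomorphic_near 0 (f i)) ->
        (\forall t \near (0 : C), \sum_i f i t *: a i t = 0) ->
        forall i, \forall t \near (0 : C), f i t = 0].

(* The determinant of Psi : lattice A (+) lattice B -> O^N with respect to the
   bases a, b and the standard basis of O^N. *)
Definition det_Psi (N p q : nat) (a : 'I_p -> C -> 'rV[C]_N)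
    (b : 'I_q -> C -> 'rV[C]_N) (t : C) : C :=
  det_coord (wedge (wedges [seq a i t | i : 'I_p])
                   (wedges [seq b j t | j : 'I_q])).

(* f has valuation v, and t^(-v) f takes the value w modulo the maximal
   ideal. *)
Definition leading_term (f : C -> C) (v : nat) (w : C) : Prop :=
  exists g : C -> C,
    [/\ holomorphic_near 0 g, g 0 != 0, g 0 = w
      & \forall t \near (0 : C), f t = t ^+ v * g t].

(* The map reg_t det Psi on the line det (A 0) (x) det (B 0) is determined by
   its value w on the generator given by the reductions a(0), b(0) of lattice
   bases, which therefore characterises the limit perturbation c. *)
Definition limit_perturbation (N : nat) (A B : C -> {vspace 'rV[C]_N})
    (c : perturbation (A 0) (B 0)) : Prop :=
  c != 0 /\
  exists (p q : nat) (a : 'I_p -> C -> 'rV[C]_N) (b : 'I_q -> C -> 'rV[C]_N)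
         (v : nat) (w : C),
    [/\ lattice_basis A a, lattice_basis B b, leading_term (det_Psi a b) v w
      & det_coord (canonical_iso (wedges [seq a i 0 | i : 'I_p])
                                 (wedges [seq b j 0 | j : 'I_q]) c) = w].

(* For complementary configurations over the complex numbers the Archimedean
   height pairing of A1 - A2 and B1 - B2 is the logarithm of the absolute
   value of the cross-ratio. *)
Definition height_pairing (N : nat) (A1 A2 B1 B2 : {vspace 'rV[C]_N}) : R :=
  ln (cmod (cross_ratio A1 A2 B1 B2)).

End HolomorphicFamilies.

(* Main.v *)
(** Let e_i and f_j be holomorphic frames near 0 of the A_i and B_j, and let
    D_ij(t) be the coordinate of the product of all vectors of e_i(t) and
    f_j(t). A lattice basis a of A and a frame e are related by e = F a with F
    holomorphic near 0 and det F(0) != 0, so the products of their vectors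
    differ by the factor det F. Hence D_ij(t) = t^v_ij g_ij(t), where g_ij(0)
    is the value of the canonical isomorphism at (e_i(0), f_j(0), c_ij). Both
    cross-ratios may be computed in these frames; therefore the cross-ratio at
    t is a power of t times g_11 g_22 / (g_12 g_21), and the leading
    coefficient of a function of the form t^m u(t) is unique. *)

Require Import Defs.
From HB Require Import structures.
From mathcomp Require Import all_boot all_order all_algebra.
From mathcomp Require Import complex zify ring.
From mathcomp Require Import all_classical all_reals all_analysis.
Import Order.TTheory GRing.Theory Num.Theory numFieldNormedType.Exports.
Local Open Scope classical_set_scope.
Local Open Scope ring_scope.

(** * Positions in index sets and selection of columns *)

(** For [i] in [S] this is the position of [i], counted from 0, in the increasing enumeration of
    [S]. *)
Definition set_rank {N : nat} (S : {set 'I_N}) (i : 'I_N) : nat :=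
  #|[set j in S | (j < i)%N]%SET|.

Lemma set_rank_lt {N : nat} {S : {set 'I_N}} {i j : 'I_N} :
  i \in S -> (i < j)%N -> (set_rank S i < set_rank S j)%N.
Proof.
move=> Si lij; apply/proper_card/properP; split.
  by apply/fintype.subsetP => l; rewrite !inE => /andP[-> /ltn_trans]; apply.
by exists i; rewrite !inE Si ?lij ?ltnn.
Qed.

Lemma set_rank_card {N : nat} {S : {set 'I_N}} {i : 'I_N} :
  i \in S -> (set_rank S i < #|S|)%N.
Proof.
move=> Si; apply/proper_card/properP; split.
  by apply/fintype.subsetP => l; rewrite !inE => /andP[].
by exists i => //; rewrite !inE ltnn andbF.
Qed.

Lemma set_rankD1 {N : nat} {S : {set 'I_N}} {i : 'I_N} (j : 'I_N) :
  i \in S -> set_rank S j = ((i < j) + set_rank (S :\ i)%SET j)%N.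
Proof.
move=> Si; rewrite /set_rank (cardsD1 i) !inE Si /=; congr (_ + _)%N.
by apply: eq_card => l; rewrite !inE andbA.
Qed.

Lemma set_rank_setT {N : nat} (i : 'I_N) : set_rank [set: 'I_N]%SET i = i.
Proof.
rewrite /set_rank -sum1dep_card.
under eq_bigl => j do rewrite inE.
rewrite -(big_ord_widen N (fun=> 1%N)); last exact: ltnW.
by rewrite sum1_card card_ord.
Qed.

(* A *m set_selector S p consists of the columns of A indexed by S, in
   increasing order, when #|S| = p *)
Definition set_selector {F : fieldType} {N : nat} (S : {set 'I_N}) (p : nat) :
  'M[F]_(N, p) := \matrix_(i, j) ((i \in S) && (set_rank S i == j))%:R.

(** Removing [i] from [S] lowers by one the rank of the elements above [i] and fixes the others,
    which is the renumbering caused by deleting column [j]. This yields the minors of a Laplace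
    expansion. *)
Lemma col'_set_selector {F : fieldType} {N p : nat} {S : {set 'I_N}}
    {i : 'I_N} (j : 'I_p.+1) : i \in S -> set_rank S i = j ->
  col' j (set_selector S p.+1) = set_selector (S :\ i)%SET p :> 'M[F]_(N, p).
Proof.
move=> Si rij; apply/matrixP => l q; rewrite !mxE in_setD1; congr (_%:R).
have [->|neq_li] /= := eqVneq l i.
  by rewrite Si rij (negbTE (neq_bump _ _)).
case Sl: (l \in S) => //=.
have {neq_li}: (l != i :> nat) by [].
have := set_rankD1 l Si; have := set_rankD1 i Si.
have := @set_rank_lt _ S l i Sl; have := @set_rank_lt _ S i l Si.
rewrite rij /= /bump; move: (set_rank S l) (set_rank (S :\ i) l) => x y; lia.
Qed.

(** * Homogeneity of the wedge product, and products of vectors as tuples of minors *)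

Lemma extZE {F : fieldType} {N : nat} (c : F) (x : @ext F N) S :
  (c *: x) S = c * x S.
Proof. by rewrite ffunE. Qed.

Lemma wedgeZl {F : fieldType} {N : nat} (c : F) (x y : @ext F N) :
  wedge (c *: x) y = c *: wedge x y.
Proof.
apply/ffunP => U; rewrite !ffunE [RHS]mulr_sumr; apply: eq_bigr => S _.
by rewrite ffunE /GRing.scale /=; ring.
Qed.

Lemma wedgeZr {F : fieldType} {N : nat} (c : F) (x y : @ext F N) :
  wedge x (c *: y) = c *: wedge x y.
Proof.
apply/ffunP => U; rewrite !ffunE [RHS]mulr_sumr; apply: eq_bigr => S _.
by rewrite ffunE /GRing.scale /=; ring.
Qed.

Lemma wedge0l {F : fieldType} {N : nat} (y : @ext F N) : wedge 0 y = 0.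
Proof. by have := wedgeZl 0 0 y; rewrite !scale0r. Qed.

Lemma wedge0r {F : fieldType} {N : nat} (x : @ext F N) : wedge x 0 = 0.
Proof. by have := wedgeZr 0 x 0; rewrite !scale0r. Qed.

Lemma wedgeZ_coord {F : fieldType} {N : nat} (x y : F) (a b : @ext F N) :
  det_coord (wedge (x *: a) (y *: b)) = x * y * det_coord (wedge a b).
Proof. by rewrite wedgeZl wedgeZr /det_coord !extZE mulrA. Qed.

(** Turns the sign in [wedge] into the cofactor sign of an expansion along the first row. *)
Lemma inversions_set1 {N : nat} (U : {set 'I_N}) (i : 'I_N) :
  inversions [set i]%SET (U :\ i)%SET = set_rank U i.
Proof.
rewrite /inversions /set_rank -[RHS](@card_imset _ _ (pair i)) => [|j l [] //].
apply: eq_card => -[j l]; apply/idP/imsetP => /=.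
  move=> /[!in_setE] /= /and3P[/[!inE] /eqP -> /andP[_ Ul] li].
  by exists l; rewrite // inE Ul.
case=> q; rewrite inE => /andP[Uq qi] [-> ->].
by apply/mem_set; rewrite /= !inE eqxx Uq qi neq_ltn qi.
Qed.

Lemma wedge_ext_vecE {F : fieldType} {N : nat} (v : 'rV[F]_N) (x : ext)
    (U : {set 'I_N}) :
  wedge (ext_vec v) x U =
    \sum_(i in U) (-1) ^+ set_rank U i * v 0 i * x (U :\ i)%SET.
Proof.
rewrite ffunE.
under eq_bigr => S _ do rewrite ffunE mulr_sumr mulr_suml.
rewrite (exchange_big_dep (mem U)) /=; last first.
  by move=> S i SU /eqP Si; move: SU; rewrite Si finset.sub1set.
apply: eq_bigr => i Ui.
rewrite (big_pred1 [set i]%SET) => [|S].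
  by rewrite inversions_set1.
rewrite /= andbC; case: eqP => // ->; by rewrite finset.sub1set Ui.
Qed.

(** These are the Plücker coordinates: maximal minors on the columns in [S]. By induction on the
    rows, multiplying by the first row on the left is the Laplace expansion along it. *)
Lemma wedges_rowsE {F : fieldType} {N p : nat} (A : 'M[F]_(p, N))
    (S : {set 'I_N}) :
  wedges [seq row i A | i : 'I_p] S =
    (#|S| == p)%:R * \det (A *m set_selector S p).
Proof.
elim: p A S => [|p IHp] A S.
  rewrite /image_mem enum_ord0 /= /wedges big_nil ffunE det_mx00 mulr1.
  by rewrite cards_eq0.
rewrite /image_mem enum_ordSl /= -map_comp /wedges big_cons wedge_ext_vecE.
set s := [seq _ | i <- _]; have -> : s = [seq row i (row' ord0 A) | i : 'I_p].
  by apply: eq_map => i; apply/rowP => j; rewrite !mxE.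
rewrite -/(wedges _).
under eq_bigr => i Si do rewrite IHp.
have [cardS|neqS] := eqVneq #|S| p.+1; last first.
  rewrite mul0r big1 // => i Si; move: neqS; rewrite (cardsD1 i) Si add1n eqSS.
  by move=> /negbTE ->; rewrite mul0r mulr0.
rewrite mul1r (expand_det_row _ ord0).
under [RHS]eq_bigr => j _ do rewrite mxE mulr_suml.
rewrite exchange_big /= big_mkcond /=; apply: eq_bigr => i _.
case: ifP => [Si|nSi]; last first.
  by rewrite big1 // => j _; rewrite mxE nSi mulr0 mul0r.
(* Row [i] of the selector has its only nonzero entry in column [set_rank S i], so each [i] in [S]
   contributes a single cofactor. *)
have ltip : (set_rank S i < p.+1)%N by rewrite -cardS set_rank_card.
rewrite (bigD1 (Ordinal ltip)) //= big1 ?addr0; last first.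
  move=> j; rewrite -val_eqE /= eq_sym => /negbTE neq.
  by rewrite mxE neq andbF mulr0 mul0r.
rewrite !mxE Si eqxx mulr1 /cofactor /= add0n.
rewrite (mulrC _ (A _ _)) -mulrA; congr (_ * (_ * _)).
have -> : #|(S :\ i)%SET| == p.
  by move: cardS; rewrite (cardsD1 i) Si add1n => -[->].
rewrite mul1r -(@col'_set_selector _ _ _ _ _ (Ordinal ltip)) //.
by congr (\det _); apply/matrixP => j l; rewrite !mxE; apply: eq_bigr => q _;
  rewrite !mxE.
Qed.

(** * Change of basis and linear independence *)

Lemma wedges_matrixE {F : fieldType} {N p : nat} (a : 'I_p -> 'rV[F]_N) :
  wedges [seq a i | i : 'I_p] = wedges [seq row i (\matrix_j a j) | i : 'I_p].
Proof. by congr wedges; apply: eq_map => i; rewrite rowK. Qed.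

(** Every coordinate is a minor, and multiplicativity of the determinant takes [\det M] out of all
    of them. *)
Lemma wedges_lincomb {F : fieldType} {N p : nat} (M : 'M[F]_p)
    (a : 'I_p -> 'rV[F]_N) :
  wedges [seq \sum_j M i j *: a j | i : 'I_p] =
    \det M *: wedges [seq a j | j : 'I_p].
Proof.
rewrite [LHS]wedges_matrixE [X in _ *: X]wedges_matrixE; apply/ffunP => S.
rewrite extZE !wedges_rowsE mulrCA -det_mulmx mulmxA. congr (_ * \det (_ *m _)).
apply/row_matrixP => i; rewrite rowK row_mul mulmx_sum_row.
by apply: eq_bigr => j _; rewrite rowK mxE.
Qed.

(** A nontrivial linear relation is a nonzero vector in the left kernel of every maximal submatrix,
    so all minors vanish. *)
Lemma free_wedges {F : fieldType} {N p : nat} (a : 'I_p -> 'rV[F]_N) :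
  wedges [seq a i | i : 'I_p] != 0 -> free [seq a i | i : 'I_p].
Proof.
have sz : size [seq a i | i : 'I_p] == p by rewrite size_map -cardE card_ord.
move=> nz; rewrite -[X in free X]/(tval (Tuple sz)).
apply/freeP => k k0 i; apply/eqP.
apply: contra_neqT nz => ki.
apply/ffunP => S; rewrite wedges_matrixE wedges_rowsE ffunE.
suff /eqP -> : \det (\matrix_i a i *m set_selector S p) == 0 by rewrite mulr0.
apply/det0P.
exists (\row_j k j).
  by apply: contra_neq ki => /rowP/(_ i); rewrite !mxE.
rewrite mulmxA (_ : _ *m \matrix_j a j = 0) ?mul0mx // mulmx_sum_row -[RHS]k0.
apply: eq_bigr => j _; rewrite rowK mxE /=.
by rewrite (nth_map j) ?nth_ord_enum // -cardE card_ord.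
Qed.

Lemma codom_nth {T : Type} (x0 : T) (s : seq T) (n : nat) :
  size s = n -> [seq nth x0 s i | i : 'I_n] = s.
Proof.
move=> <-; rewrite -[RHS](mkseq_nth x0) /mkseq -val_enum_ord -map_comp.
exact: eq_map.
Qed.

Lemma wedges_cat_neq0 {F : fieldType} {N : nat} (s1 s2 : seq 'rV[F]_N) :
  wedges (s1 ++ s2) != 0 -> wedges s2 != 0.
Proof.
elim: s1 => //= v s1 IHs; rewrite {1}/wedges big_cons -/(wedges _) => nz.
by apply: IHs; apply: contra_neq nz => ->; rewrite wedge0r.
Qed.

(** The coordinate at the full index set is the determinant of an invertible matrix. *)
Lemma wedges_basis_neq0 {F : fieldType} {N : nat} (s : seq 'rV[F]_N) :
  basis_of fullv s -> wedges s != 0.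
Proof.
move=> bs; have sz : size s = N.
  by rewrite -(size_basis (X := in_tuple s) bs) dimvf dim_matrix mul1r.
rewrite -(codom_nth 0 _ _ sz) wedges_matrixE.
set A := \matrix_i s`_i.
have : \det A != 0.
  rewrite -unitfE -unitmxE -row_free_unit; apply: inj_row_free => v vA0.
  apply/rowP => i; rewrite mxE.
  have sz' : size s == N by apply/eqP.
  have : free (Tuple sz') := basis_free bs.
  move=> /freeP/(_ (v 0)); apply.
  rewrite -[RHS]vA0 mulmx_sum_row.
  by apply: eq_bigr => j _; rewrite rowK.
apply: contra_neq => /ffunP/(_ [set: 'I_N]%SET); rewrite wedges_rowsE.
have -> : set_selector [set: 'I_N]%SET N = 1%:M :> 'M[F]_N.
  by apply/matrixP => i j; rewrite !mxE finset.in_setT set_rank_setT.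
by rewrite mulmx1 cardsT card_ord eqxx mul1r ffunE.
Qed.

Lemma wedges_free_neq0 {F : fieldType} {N : nat} (s : seq 'rV[F]_N) :
  free s -> wedges s != 0.
Proof.
(* It suffices to treat a basis of the whole space extending s to the left. *)
move=> fs; apply: (wedges_cat_neq0 (vbasis (<< s >>^C)%VS)).
apply: wedges_basis_neq0; rewrite -(addv_complf << s >>%VS) addvC.
apply: cat_basis; [|exact: vbasisP|by rewrite /basis_of eqxx].
by apply/directv_addP; rewrite capvC capv_compl.
Qed.

(** The scalar is the determinant of the matrix expressing [vbasis W] in the basis [e]; it is
    nonzero because [detgen W] is. *)
Lemma detgen_basis {F : fieldType} {N d : nat} {W : {vspace 'rV[F]_N}}
    {e : 'I_d -> 'rV[F]_N} : basis_of W [seq e i | i : 'I_d] ->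
  exists2 c : F, c != 0 & detgen W = c *: wedges [seq e i | i : 'I_d].
Proof.
move=> be; have sz : size [seq e i | i : 'I_d] == d.
  by rewrite size_map -cardE card_ord.
have dimW : d = \dim W by rewrite (size_basis (X := Tuple sz) be).
pose M := \matrix_(i, j < d) coord (Tuple sz) j (vbasis W)`_i.
have eqW : detgen W = \det M *: wedges [seq e i | i : 'I_d].
  rewrite -wedges_lincomb /detgen -[LHS]/(wedges (vbasis W)).
  rewrite -(codom_nth 0 (vbasis W) d) ?size_tuple //.
  congr wedges; apply: eq_map => i.
  have /(coord_basis (X := Tuple sz) be) {1}-> : (vbasis W)`_i \in W.
    by apply: vbasis_mem; rewrite mem_nth // size_tuple -dimW.
  apply: eq_bigr => j _; rewrite mxE /=.
  by rewrite (nth_map j) ?nth_ord_enum // -cardE card_ord.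
exists (\det M) => //.
have : detgen W != 0 by apply: wedges_free_neq0; apply: basis_free (vbasisP W).
by apply: contra_neq => M0; rewrite eqW M0 scale0r.
Qed.

(** [a] enters through [wedge], and [b] only through the linear form [coord]. *)
Lemma canonical_isoZ {F : fieldType} {N : nat} {A B : {vspace 'rV[F]_N}}
    (x y : F) (a b : ext) (c : perturbation A B) :
  det_coord (canonical_iso (x *: a) (y *: b) c) =
    x * y * det_coord (canonical_iso a b c).
Proof.
rewrite /canonical_iso linearZ /= -scalerA !wedgeZl wedgeZr wedgeZl.
by rewrite /det_coord !ffunE /GRing.scale /= mulrA.
Qed.

(** * Holomorphic frames and lattice bases near 0 *)

Lemma holomorphic_continuous {R : realType} {z : Cx R} {f : Cx R -> Cx R} :
  holomorphic_near z f -> {for z, continuous f}.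
Proof.
move=> /nbhs_singleton /derivable1_diffP.
exact: (@differentiable_continuous _ (Cx R)^o (Cx R)^o).
Qed.

Lemma continuous_det {K : numFieldType} {d : nat} {z : K}
    (M : K -> 'M[K]_d) :
  (forall i j, {for z, continuous (fun t => M t i j)}) ->
  {for z, continuous (fun t => \det (M t))}.
Proof.
move=> cM; have cvgT := @nbhs_filter K z.
apply: cvg_big; first exact: add_continuous.
move=> s _; apply: cvgM; first exact: cvg_cst.
by apply: cvg_big; [exact: mul_continuous|move=> i _; exact: cM].
Qed.

(** The frame lies in the lattice, so it has holomorphic coefficients in the basis [a], and [delta]
    is their determinant. It does not vanish at 0 because the frame is independent there. *)
Lemma wedges_lattice_basis {R : realType} {N d p : nat}
    {A : Cx R -> {vspace 'rV[Cx R]_N}} {e : 'I_d -> Cx R -> 'rV[Cx R]_N}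
    {a : 'I_p -> Cx R -> 'rV[Cx R]_N} :
  (forall i, vholomorphic_near 0 (e i)) ->
  (\forall t \near (0 : Cx R), basis_of (A t) [seq e i t | i : 'I_d]) ->
  lattice_basis A a ->
  (\forall t \near (0 : Cx R)^', wedges [seq a i t | i : 'I_p] != 0) ->
  exists delta : Cx R -> Cx R,
    [/\ {for 0, continuous delta}, delta 0 != 0
      & \forall t \near (0 : Cx R), wedges [seq e i t | i : 'I_d] =
          delta t *: wedges [seq a i t | i : 'I_p]].
Proof.
move=> he be [la ga _] nza.
have le i : lattice A (e i).
  split=> //; apply: nbhs_dnbhs; apply: filterS be => t /basis_mem; apply.
  exact: fintype.image_f.
have /choice[f hf] i := ga _ (le i).
have ef : \forall t \near (0 : Cx R),
    forall i, e i t = \sum_j f i j t *: a j t.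
  apply: (@filter_forall _ _ (fun i t => e i t = \sum_j f i j t *: a j t) _
            (@nbhs_filter (Cx R) 0)) => i.
  by case: (hf i).
have sz (q : nat) (b : 'I_q -> 'rV[Cx R]_N) : size [seq b i | i : 'I_q] == q.
  by rewrite size_map -cardE card_ord.
(* d <= p is read off at 0, where e is free, and p <= d at a nearby t != 0,
   where a is free. *)
have ledp : (d <= p)%N.
  have b0 := nbhs_singleton be; have e0 := nbhs_singleton ef.
  rewrite -(eqP (sz _ (e^~ 0))) -(eqnP (basis_free b0)).
  rewrite -(eqP (sz _ (a^~ 0))); apply: leq_trans (dim_span _).
  apply/dimvS/span_subvP => _ /fintype.imageP[i _ ->]; rewrite e0.
  by apply: memv_suml => j _; apply: memvZ; apply: memv_span;
    exact: fintype.image_f.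
have lepd : (p <= d)%N.
  have at_ : \forall t \near (0 : Cx R)^', forall i, a i t \in A t.
    apply: (@filter_forall _ _ (fun i t => a i t \in A t)) => i.
  by case: (la i).
  have /filter_ex[t [[nz aA] bt]] : \forall t \near (0 : Cx R)^',
      (wedges [seq a i t | i : 'I_p] != 0 /\ (forall i, a i t \in A t)) /\
       basis_of (A t) [seq e i t | i : 'I_d].
    by apply: filterI; [exact: filterI | exact: nbhs_dnbhs be].
  rewrite -(eqP (sz _ (a^~ t))) -(eqnP (free_wedges _ nz)).
  rewrite -(size_basis (X := Tuple (sz _ (e^~ t))) bt); apply: dimvS.
  by apply/span_subvP => _ /fintype.imageP[i _ ->].
have eqdp : d = p by apply/eqP; rewrite eqn_leq ledp lepd.
(* Once [p] is replaced by [d], the coefficient matrix is square. *)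
case: _ / eqdp {ledp lepd} a la ga nza f hf ef => a la ga nza f hf ef.
exists (fun t => \det (\matrix_(i, j) f i j t)).
have ef' : \forall t \near (0 : Cx R), wedges [seq e i t | i : 'I_d] =
    \det (\matrix_(i, j) f i j t) *: wedges [seq a i t | i : 'I_d].
  apply: filterS ef => t et; rewrite -wedges_lincomb; congr wedges.
  by apply: eq_map => i; rewrite et; apply: eq_bigr => j _; rewrite mxE.
split=> //.
  apply: continuous_det => i j.
  have -> : (fun t => (\matrix_(i, j) f i j t) i j) = f i j.
    by apply/funext => t; rewrite mxE.
  by apply: holomorphic_continuous; case: (hf i).
have := wedges_free_neq0 _ (basis_free (nbhs_singleton be)).
by apply: contra_neq => d0; rewrite (nbhs_singleton ef') d0 scale0r.
Qed.

(** Passing from lattice bases to frames multiplies [det_Psi] and the canonical isomorphism by the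
    same factor, a unit at 0. Hence the valuation is kept and the two leading values still agree. *)
Lemma leading_term_pair {R : realType} {N d d' : nat}
    {A B : Cx R -> {vspace 'rV[Cx R]_N}} {e : 'I_d -> Cx R -> 'rV[Cx R]_N}
    {f : 'I_d' -> Cx R -> 'rV[Cx R]_N} {c : perturbation (A 0) (B 0)} :
  (forall i, vholomorphic_near 0 (e i)) ->
  (\forall t \near (0 : Cx R), basis_of (A t) [seq e i t | i : 'I_d]) ->
  (forall i, vholomorphic_near 0 (f i)) ->
  (\forall t \near (0 : Cx R), basis_of (B t) [seq f i t | i : 'I_d']) ->
  limit_perturbation c ->
  exists (v : nat) (g : Cx R -> Cx R),
    [/\ {for 0, continuous g}, g 0 != 0,
        \forall t \near (0 : Cx R), det_Psi e f t = t ^+ v * g t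
      & det_coord (canonical_iso (wedges [seq e i 0 | i : 'I_d])
                                 (wedges [seq f j 0 | j : 'I_d']) c) = g 0].
Proof.
move=> he be hf bf [_ [p [q [a [b [v [w [la lb [g [hg g0 <- dg]] cw]]]]]]]].
(* Off 0 both products of lattice basis vectors are nonzero, since their wedge is; this allows the
   comparison with the frames. *)
have nz : \forall t \near (0 : Cx R)^', det_Psi a b t != 0.
  have nz0 : \forall t \near (0 : Cx R)^', t != 0 := nbhs_dnbhs_neq 0.
  have gnz : \forall t \near (0 : Cx R), g t != 0.
    exact: cvgr_neq0 (holomorphic_continuous hg) g0.
  near=> t; rewrite (near (nbhs_dnbhs dg)) // mulf_neq0 ?expf_neq0 //.
    by near: t.
  by near: t; apply: nbhs_dnbhs.
have [x [cx x0 ex]] : exists delta : Cx R -> Cx R,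
    [/\ {for 0, continuous delta}, delta 0 != 0
      & \forall t \near (0 : Cx R), wedges [seq e i t | i : 'I_d] =
          delta t *: wedges [seq a i t | i : 'I_p]].
  apply: wedges_lattice_basis he be la _; apply: filterS nz => t.
  by apply: contra_neq => a0; rewrite /det_Psi a0 wedge0l /det_coord ffunE.
have [y [cy y0 fy]] : exists delta : Cx R -> Cx R,
    [/\ {for 0, continuous delta}, delta 0 != 0
      & \forall t \near (0 : Cx R), wedges [seq f i t | i : 'I_d'] =
          delta t *: wedges [seq b i t | i : 'I_q]].
  apply: wedges_lattice_basis hf bf lb _; apply: filterS nz => t.
  by apply: contra_neq => b0; rewrite /det_Psi b0 wedge0r /det_coord ffunE.
exists v, ((x \* y) \* g); split.
- exact: continuousM (continuousM cx cy) (holomorphic_continuous hg).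
- by rewrite !mulf_neq0.
- near=> t.
  rewrite /det_Psi (near ex t) // (near fy t) // wedgeZ_coord.
  by rewrite -/(det_Psi a b t) (near dg t) //= mulrCA.
- by rewrite (nbhs_singleton ex) (nbhs_singleton fy) canonical_isoZ cw.
Unshelve. all: by end_near. Qed.

(** * Cross-ratios in arbitrary bases *)

Lemma scaled_cross_ratio {K : fieldType} (x1 x2 y1 y2 d11 d12 d21 d22 : K) :
  x1 != 0 -> x2 != 0 -> y1 != 0 -> y2 != 0 ->
  (x1 * y1 * d11) / (x1 * y2 * d12) * ((x2 * y2 * d22) / (x2 * y1 * d21)) =
    d11 / d12 * (d22 / d21).
Proof.
(* The quotients of the [d]s, which may have zero denominators, are split off first, so that [field]
   only meets the nonzero scalars. *)
move=> x10 x20 y10 y20; rewrite -!(mulf_div (_ * _)) mulrACA.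
by rewrite [X in X * _](_ : _ = 1) ?mul1r //; field; rewrite x10 x20 y10 y20.
Qed.

Section Frames.
Context {F : fieldType} {N d d' : nat} {A1 A2 B1 B2 : {vspace 'rV[F]_N}}.
Context {e1 e2 : 'I_d -> 'rV[F]_N} {f1 f2 : 'I_d' -> 'rV[F]_N}.
Hypotheses (be1 : basis_of A1 [seq e1 i | i : 'I_d])
  (be2 : basis_of A2 [seq e2 i | i : 'I_d])
  (bf1 : basis_of B1 [seq f1 i | i : 'I_d'])
  (bf2 : basis_of B2 [seq f2 i | i : 'I_d']).
Let a1 := wedges [seq e1 i | i : 'I_d].
Let a2 := wedges [seq e2 i | i : 'I_d].
Let b1 := wedges [seq f1 i | i : 'I_d'].
Let b2 := wedges [seq f2 i | i : 'I_d'].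

Lemma cross_ratio_frame : cross_ratio A1 A2 B1 B2 =
  det_coord (wedge a1 b1) / det_coord (wedge a1 b2) *
  (det_coord (wedge a2 b2) / det_coord (wedge a2 b1)).
Proof.
have [x1 x10 ex1] := detgen_basis be1; have [x2 x20 ex2] := detgen_basis be2.
have [y1 y10 ey1] := detgen_basis bf1; have [y2 y20 ey2] := detgen_basis bf2.
by rewrite /cross_ratio ex1 ex2 ey1 ey2 !wedgeZ_coord scaled_cross_ratio.
Qed.

Lemma degenerate_cross_ratio_frame
    {c11 : perturbation A1 B1} {c12 : perturbation A1 B2}
    {c21 : perturbation A2 B1} {c22 : perturbation A2 B2}
    {w11 w12 w21 w22 : F} :
  det_coord (canonical_iso a1 b1 c11) = w11 ->
  det_coord (canonical_iso a1 b2 c12) = w12 ->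
  det_coord (canonical_iso a2 b1 c21) = w21 ->
  det_coord (canonical_iso a2 b2 c22) = w22 ->
  degenerate_cross_ratio c11 c12 c21 c22 = w11 / w12 * (w22 / w21).
Proof.
move=> <- <- <- <-.
have [x1 x10 ex1] := detgen_basis be1; have [x2 x20 ex2] := detgen_basis be2.
have [y1 y10 ey1] := detgen_basis bf1; have [y2 y20 ey2] := detgen_basis bf2.
rewrite /degenerate_cross_ratio ex1 ex2 ey1 ey2 !canonical_isoZ.
exact: scaled_cross_ratio.
Qed.

End Frames.

(** * Uniqueness of the leading coefficient *)

(** Both values are limits of the same germ along the punctured neighbourhoods, and limits are
    unique. *)
Lemma dnbhs_eq {K : numFieldType} {f g : K -> K} {z : K} :
  {for z, continuous f} -> {for z, continuous g} ->
  (\forall t \near z^', f t = g t) -> f z = g z.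
Proof.
move=> /continuous_withinNx cf /continuous_withinNx cg fg.
apply: (cvg_unique (@norm_hausdorff K K)) cf _.
by apply: cvg_trans cg; apply: near_eq_cvg; apply: filterS fg.
Qed.

(** Dividing by the lower power of [t] leaves an identity [t ^+ n * u t = g t] off 0, which extends
    to 0 by continuity. *)
Lemma leading_coef_unique {K : numFieldType} {m m' : int} {u g : K -> K} :
  {for 0, continuous u} -> {for 0, continuous g} -> u 0 != 0 -> g 0 != 0 ->
  (\forall t \near (0 : K)^', t ^ m * u t = t ^ m' * g t) -> u 0 = g 0.
Proof.
move=> cu cg u0 g0 eq_ug.
wlog le_m'm : m m' u g cu cg u0 g0 eq_ug / (m' <= m)%R.
  move=> IH; case: (lerP m' m) => [|/ltW] le_m; first exact: IH eq_ug le_m.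
  by apply/esym; apply: IH le_m => //; apply: filterS eq_ug.
have [n mE] : exists n : nat, m = m' + n by exists `|m - m'|%N; lia.
have cX : {for 0, continuous (fun t : K => t ^+ n)}.
  elim: (n) => [|k IHk]; first exact: cst_continuous.
  rewrite (_ : (fun t => _) = id \* (fun t => t ^+ k)).
    by apply: continuousM IHk.
  by apply/funext => t; rewrite exprS.
have := dnbhs_eq (continuousM cX cu) cg.
have nz0 : \forall t \near (0 : K)^', t != 0 := nbhs_dnbhs_neq 0.
have eqn : \forall t \near (0 : K)^', t ^+ n * u t = g t.
  apply: filterS2 nz0 eq_ug => t t0.
  rewrite mE expfzDr // -mulrA => /mulfI; apply.
  by rewrite expfz_neq0.
(* At 0 the power is 1 if [n] is 0; a positive [n] would force [g 0 = 0]. *)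
move=> /(_ eqn) /=; rewrite expr0n; case: (n) => [|k]; first by rewrite mul1r.
by rewrite mul0r => /esym/eqP; rewrite (negbTE g0).
Qed.

(** * Logarithms of absolute values *)

Lemma cmodE {R : realType} (z : Cx R) : cmod z = Normc.normc (z : R[i]).
Proof. by []. Qed.

Lemma cmod_gt0 {R : realType} (z : Cx R) : z != 0 -> 0 < cmod z.
Proof.
move=> z0; rewrite lt_def cmodE; apply/andP; split.
  by apply: contra_neq z0 => /Normc.eq0_normc.
by case: z {z0} => a b; exact: sqrtr_ge0.
Qed.

Lemma ln_cmodM {R : realType} (x y : Cx R) : x != 0 -> y != 0 ->
  ln (cmod (x * y)) = ln (cmod x) + ln (cmod y).
Proof.
move=> x0 y0; rewrite -lnM ?posrE ?cmod_gt0 // !cmodE.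
by congr ln; exact: Normc.normcM.
Qed.

Lemma ln_cmodXz {R : realType} (x : Cx R) (m : int) : x != 0 ->
  ln (cmod (x ^ m)) = m%:~R * ln (cmod x).
Proof.
move=> x0; have cmod1 : ln (cmod (1 : Cx R)) = 0.
  by apply: (addrI (ln (cmod (1 : Cx R))));
    rewrite -ln_cmodM ?mulr1 ?addr0 ?oner_neq0.
have lnX (n : nat) : ln (cmod (x ^+ n)) = n%:R * ln (cmod x).
  elim: n => [|n IHn]; first by rewrite mul0r.
  by rewrite exprS ln_cmodM ?expf_neq0 // IHn -natr1; ring.
case: m => n; first exact: lnX.
(* A negative power is handled by adding the logarithm of its inverse, which gives the logarithm of
   1. *)
apply: (addIr (ln (cmod (x ^+ n.+1)))).
rewrite -ln_cmodM ?invr_neq0 ?expf_neq0 // mulVf ?expf_neq0 //.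
by rewrite cmod1 lnX NegzE mulrNz mulNr addNr.
Qed.

(** * Asymptotics of the height pairing and the value of [u] at 0 *)

Theorem corollaryC (R : realType) (n k : nat) (r : R)
    (A1 A2 B1 B2 : Cx R -> {vspace 'rV[Cx R]_n.+1})
    (hr : 0 < r)
    (hA1 : holomorphic_family r k.+1 A1) (hA2 : holomorphic_family r k.+1 A2)
    (hB1 : holomorphic_family r (n - k)%N B1)
    (hB2 : holomorphic_family r (n - k)%N B2)
    (hcompl : forall t : Cx R, disk r t -> t != 0 ->
       complementary k (A1 t) (A2 t) (B1 t) (B2 t))
    (m : int) (u : Cx R -> Cx R)
    (hu : holomorphic_near 0 u) (hu0 : u 0 != 0)
    (hcr : \forall t \near (0 : Cx R)^',
       cross_ratio (A1 t) (A2 t) (B1 t) (B2 t) = t ^ m * u t)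
    (c11 : perturbation (A1 0) (B1 0)) (c12 : perturbation (A1 0) (B2 0))
    (c21 : perturbation (A2 0) (B1 0)) (c22 : perturbation (A2 0) (B2 0))
    (hc11 : limit_perturbation c11) (hc12 : limit_perturbation c12)
    (hc21 : limit_perturbation c21) (hc22 : limit_perturbation c22) :
  (\forall t \near (0 : Cx R)^',
     height_pairing (A1 t) (A2 t) (B1 t) (B2 t)
       = m%:~R * ln (cmod t) + ln (cmod (u t)))
  /\ u 0 = degenerate_cross_ratio c11 c12 c21 c22.
Proof.
have nz0 : \forall t \near (0 : Cx R)^', t != 0 := nbhs_dnbhs_neq 0.
have cu := holomorphic_continuous hu.
split.
  have unz : \forall t \near (0 : Cx R)^', u t != 0.
    by apply: nbhs_dnbhs; exact: cvgr_neq0 cu hu0.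
  near=> t; have t0 : t != 0 by near: t.
  rewrite /height_pairing (near hcr t) // ln_cmodM ?expfz_neq0 //.
    by rewrite ln_cmodXz.
  by near: t.
have disk0 : disk r (0 : Cx R) by rewrite /disk /= cmodE Normc.normc0.
have [e1 [he1 be1]] := hA1 _ disk0; have [e2 [he2 be2]] := hA2 _ disk0.
have [f1 [hf1 bf1]] := hB1 _ disk0; have [f2 [hf2 bf2]] := hB2 _ disk0.
have [v11 [g11 [cg11 g110 D11 w11]]] := leading_term_pair he1 be1 hf1 bf1 hc11.
have [v12 [g12 [cg12 g120 D12 w12]]] := leading_term_pair he1 be1 hf2 bf2 hc12.
have [v21 [g21 [cg21 g210 D21 w21]]] := leading_term_pair he2 be2 hf1 bf1 hc21.
have [v22 [g22 [cg22 g220 D22 w22]]] := leading_term_pair he2 be2 hf2 bf2 hc22.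
rewrite (degenerate_cross_ratio_frame (nbhs_singleton be1) (nbhs_singleton be2)
  (nbhs_singleton bf1) (nbhs_singleton bf2) w11 w12 w21 w22).
(* [G] is the cross-ratio of the unit parts; [G 0] unfolds to the right-hand side of the goal. *)
pose G := (g11 \* (fun t => (g12 t)^-1)) \* (g22 \* (fun t => (g21 t)^-1)).
have cG : {for 0, continuous G}.
  exact: continuousM (continuousM cg11 (continuousV g120 cg12))
                     (continuousM cg22 (continuousV g210 cg21)).
have G0 : G 0 != 0 by rewrite /G /= !mulf_neq0 ?invr_eq0.
(* The exponent is the same alternating combination of the four valuations, taken in the integers
   because it may be negative. *)
apply: (leading_coef_unique cu cG hu0 G0
  (m := m) (m' := v11%:Z - v12%:Z + (v22%:Z - v21%:Z))).
near=> t; have t0 : t != 0 by near: t.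
rewrite -(near hcr t) // (cross_ratio_frame (near (nbhs_dnbhs be1) t _)
  (near (nbhs_dnbhs be2) t _) (near (nbhs_dnbhs bf1) t _)
  (near (nbhs_dnbhs bf2) t _)) //.
rewrite -!/(det_Psi _ _ t) (near (nbhs_dnbhs D11) t) //.
rewrite (near (nbhs_dnbhs D12) t) // (near (nbhs_dnbhs D21) t) //.
rewrite (near (nbhs_dnbhs D22) t) //.
rewrite !expfzDr // -!invr_expz /G /=.
by rewrite !invfM -!exprnP; ring.
Unshelve. all: by end_near. Qed.
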